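(* There exists a function $f:\mathbb{Z}_{>0}\times\mathbb{Z}_{>0}\to\mathbb{Z}_{>0}$ with the following property. Let $m,n$ be positive integers and let $G$ be a group (not necessarily finite). If $|x^{X_n(G)}|\le m$ for every $x\in G$, then $\gamma_{n+1}(G)$ is finite and $|\gamma_{n+1}(G)|\le f(m,n)$.
   Context: Commutators are $[a,b]=a^{-1}b^{-1}ab$, and longer commutators are left-normed: $[x_1,\dots,x_n]=[[x_1,\dots,x_{n-1}],x_n]$, with $[x_1]=x_1$. $X_n(G)=\{[g_1,\dots,g_n]\mid g_1,\dots,g_n\in G\}$ is the set of $\gamma_n$-values in $G$ (so $X_1(G)=G$); it is a set, not a subgroup in general. $\gamma_i(G)$ denotes the $i$th term of the lower central series of $G$: $\gamma_1(G)=G$ and $\gamma_{i+1}(G)=[\gamma_i(G),G]$. For $x\in G$ and a subset $S\subseteq G$, $x^S=\{x^s\mid s\in S\}$, where $x^s=s^{-1}xs$. *)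

(* Defs.v *)
From mathcomp Require Import all_boot.
From mathcomp Require Import boolp classical_sets functions cardinality.

Set Implicit Arguments.
Unset Strict Implicit.
Unset Printing Implicit Defensive.

Local Open Scope classical_set_scope.
Local Open Scope group_scope.

(* [~ x, y] is x^-1 * (y^-1 * (x * y)) and x ^ y is y^-1 * (x * y); the value
   on the empty sequence is a dummy. *)
Definition left_normed_comm (G : groupType) (s : seq G) : G :=
  if s is x :: s' then foldl (@commg G) x s' else 1.

(* The set X_n(G) of gamma_n-values; meaningful for n > 0. *)
Definition gamma_values n (G : groupType) : set G :=
  range (fun g : n.-tuple G => left_normed_comm g).
Arguments gamma_values n G : clear implicits.

Definition conj_by (G : groupType) (x : G) (S : set G) : set G :=
  [set x ^ s | s in S].

Definition generated_subgroup (G : groupType) (S : set G) : set G :=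
  smallest (fun H : set G => group_closed (mem H)) S.

Definition comm_subgroup (G : groupType) (A B : set G) : set G :=
  generated_subgroup [set [~ a, b] | a in A & b in B].

(* Terms are numbered from 1, so that the index 0 is a dummy (it gives G). *)
Definition lower_central_term (i : nat) (G : groupType) : set G :=
  iter i.-1 (fun H : set G => comm_subgroup H setT) setT.
Arguments lower_central_term i G : clear implicits.

(* Main.v *)
(* Write X for the set of gamma_n-values. The hypothesis bounds [v, a] for a
   fixed and v ranging over X. By Neumann's argument, if moreover [s, y] is
   bounded for each fixed s in X, y ranging over a set Y, then the set of all
   [s, y] is bounded. For Y the set of gamma_j-values this is established by
   descending induction on j, the case j = 1 saying that the set of
   gamma_(n+1)-values is bounded: for c = [a, b] a fixed gamma_(i+1)-value,
   i + j = n, and v a varying gamma_j-value, a commutator identity expresses [v, c] through [v, a],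
   [v, b] and their commutators, which are controlled by the previous stage.

   It remains to see that gamma_r(G) is bounded when the set X of gamma_r-values
   is. Schur's theorem bounds the derived subgroup of E = gamma_r(G). Modulo E',
   [v, g_2, ..., g_r] is additive in v in E, and its values lie in X, so it has
   bounded order: gamma_(2r-1)-values are torsion and gamma_(2r-1)(G) is bounded.
   Finally, for s = 2r-2, ..., r, modulo gamma_(s+1)(G) the commutator
   [x_1, ..., x_s] is additive in x_1, so gamma_s-values are torsion too. *)
Require Import Defs.
From mathcomp Require Import all_boot.
From mathcomp Require Import boolp classical_sets functions cardinality.

Set Implicit Arguments.
Unset Strict Implicit.
Unset Printing Implicit Defensive.

Local Open Scope classical_set_scope.
Local Open Scope card_scope.

(** * Sets covered by lists of bounded length *)

(** The list may repeat entries and contain elements outside [A], so bounds pass to subsets and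
    images without exact counting. *)
Definition bounded_by (T : eqType) (k : nat) (A : set T) :=
  exists2 s : seq T, size s <= k & forall x, A x -> x \in s.

Lemma bounded_byW (T : eqType) k l (A B : set T) :
  k <= l -> A `<=` B -> bounded_by k B -> bounded_by l A.
Proof.
move=> kl AB [s sk Bs]; exists s; first exact: leq_trans sk kl.
by move=> x /AB /Bs.
Qed.

Lemma sub_bounded_by (T : eqType) k (A B : set T) :
  A `<=` B -> bounded_by k B -> bounded_by k A.
Proof. exact: bounded_byW. Qed.

Lemma bounded_by_bigcup (T U : eqType) k l (A : set T) (B : T -> set U) :
  bounded_by k A -> (forall x, A x -> bounded_by l (B x)) ->
  bounded_by (k * l) (\bigcup_(x in A) B x).
Proof.
move=> [s sk As] Bl.
(* Only the entries of [s] that lie in [A] come with a bound on [B x]. *)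
have {As} : \bigcup_(x in A) B x `<=` \bigcup_(x in A `&` [set` s]) B x.
  by move=> y [x Ax Bxy]; exists x => //; split => //=; apply: As.
move/sub_bounded_by; apply; apply: (@bounded_byW _ (size s * l) _ _ _ _ (@subset_refl _ _)).
  by rewrite leq_mul2r sk orbT.
elim: s {sk} => [|z s [u us su]]; first by exists [::] => // y [x [_ ]].
have [Az|nAz] := pselect (A z).
- have [w wl Bw] := Bl z Az; exists (w ++ u).
    by rewrite size_cat mulSn leq_add.
  move=> y [x [Ax /=]]; rewrite inE => /orP[/eqP -> /Bw|xs Bxy].
    by rewrite mem_cat => ->.
  by rewrite mem_cat su ?orbT//; exists x.
- exists u; first by rewrite (leq_trans us)// leq_mul2r leqnSn orbT.
  move=> y [x [Ax /=]]; rewrite inE => /orP[/eqP xz|xs Bxy].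
    by rewrite xz in Ax.
  by apply: su; exists x.
Qed.

Lemma bounded_by_image (T U : eqType) k (f : T -> U) (A : set T) :
  bounded_by k A -> bounded_by k (f @` A).
Proof.
move=> [s sk As]; exists (map f s); first by rewrite size_map.
by move=> _ [x Ax <-]; apply/map_f/As.
Qed.

Lemma bounded_by_image2 (T U W : eqType) k l (f : T -> U -> W) A B :
  bounded_by k A -> bounded_by l B ->
  bounded_by (k * l) [set f a b | a in A & b in B].
Proof.
move=> Ak Bl; apply: sub_bounded_by; last first.
  by apply: (bounded_by_bigcup Ak) => a _; apply: (bounded_by_image (f a) Bl).
by move=> _ [a Aa [b Bb <-]]; exists a => //; exists b.
Qed.

(** The image is the union, over the key values, of the images of the fibres. Below, a key records
    how an element conjugates a finite list. *)
Lemma bounded_by_fiber (I : Type) (K T : eqType) k l (key : I -> K)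
    (val : I -> T) (D : set I) :
  bounded_by k (key @` D) ->
  (forall t, D t ->
     bounded_by l [set val i | i in [set i | D i /\ key i = key t]]) ->
  bounded_by (k * l) (val @` D).
Proof.
move=> Dk Dl; apply: sub_bounded_by; last first.
  apply: (@bounded_by_bigcup _ _ k l _
    (fun x => [set val i | i in [set i | D i /\ key i = x]]) Dk).
  by move=> _ [t Dt <-]; apply: Dl.
by move=> _ [i Di <-]; exists (key i); [exists i|exists i].
Qed.

Lemma bounded_by_key (I : Type) (K T : eqType) k (key : I -> K)
    (val : I -> T) (D : set I) :
  bounded_by k (key @` D) ->
  (forall i j, D i -> D j -> key i = key j -> val i = val j) ->
  bounded_by k (val @` D).
Proof.
move=> Dk Dl; rewrite -[k]muln1; apply: (bounded_by_fiber Dk) => t Dt.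
exists [:: val t] => // _ [i [Di it] <-]; rewrite inE; apply/eqP.
exact: Dl.
Qed.

Lemma bounded_by_map (I : Type) (S T : eqType) k (f : S -> I -> T)
    (D : set I) (s : seq S) :
  (forall x, x \in s -> bounded_by k [set f x i | i in D]) ->
  bounded_by (k ^ size s) [set [seq f x i | x <- s] | i in D].
Proof.
elim: s => [_|x s IHs sk].
  by exists [:: [::]] => // _ [i _ <-].
rewrite /= expnS; apply: sub_bounded_by; last first.
  apply: (bounded_by_image2 cons (sk x (mem_head x s)) (IHs _)) => y ys.
  by apply: sk; rewrite inE ys orbT.
by move=> _ [i Di <-]; exists (f x i); [exists i|exists [seq f x i | x <- s] => //; exists i].
Qed.

Lemma uniq_size_bounded_by (T : eqType) k (A : set T) (s : seq T) :
  bounded_by k A -> uniq s -> (forall x, x \in s -> A x) -> size s <= k.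
Proof.
move=> [u uk Au] us sA; apply: leq_trans uk; apply: uniq_leq_size us _.
by move=> x /sA /Au.
Qed.

Lemma bounded_byP (T : choiceType) k (A : set T) :
  bounded_by k A <-> A #<= `I_k.
Proof.
split=> [[s sk As]|Ak].
  have [->|/set0P[x0 _]] := eqVneq A set0; first exact: card_ge0.
  apply: (@card_le_trans _ _ _ (nth x0 s @` `I_k)); last exact: card_image_le.
  apply: subset_card_le => x /As xs; exists (index x s); last exact: nth_index.
  by rewrite /= (leq_trans _ sk)// index_mem.
have Afin : finite_set A by apply/finite_set_leP; exists k.
exists (finmap.enum_fset (fset_set A)); first exact: geq_card_fset_set.
by move=> x Ax; rewrite in_fset_set// inE.
Qed.

(** * Commutator calculus for gamma-values and their products *)

Local Open Scope group_scope.

Ltac group_word :=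
  rewrite /commg /conjg ?(invgM, invgK, invg1, mulgA, mulgK, mulgVK, mulgV, mulVg,
    mul1g, mulg1).

(** The index is shifted by one: [gval G j] is the set of gamma_(j+1)-values, and [gval G 0] is
    G. *)
Fixpoint gval (G : groupType) j : set G :=
  if j is j'.+1 then [set [~ x, g] | x in @gval G j' & g in setT] else setT.
Arguments gval G j : clear implicits.

Lemma gamma_valuesE (G : groupType) j : gamma_values j.+1 G = gval G j.
Proof.
have -> : gamma_values j.+1 G =
    [set foldl (@commg G) x s | x in setT & s in [set s | size s = j]].
  apply/seteqP; split=> [_ [t _ <-]|_ [x _ [s /= sj <-]]].
    by case/tupleP: t => x t; exists x => //; exists (val t); rewrite //= size_tuple.
  have sP : size (x :: s) == j.+1 by rewrite /= sj.
  by exists (Tuple sP).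
elim: j => [|j IHj]; apply/seteqP; split=> //.
- by move=> x _; exists x => //; exists [::].
- move=> _ [x _ [s + <-]]; case: (lastP s) => // {}s g /=.
  rewrite size_rcons => -[sj]; rewrite foldl_rcons; exists (foldl (@commg G) x s).
    by rewrite -IHj; exists x => //; exists s.
  by exists g.
- move=> _ [x Vx [g _ <-]].
  move/seteqP: IHj => [_ /(_ x Vx)] [y _ [s /= sj <-]].
  by exists y => //; exists (rcons s g); rewrite /= ?size_rcons ?sj ?foldl_rcons.
Qed.

Section GammaValues.
Variable G : groupType.
Implicit Types (x y z g h : G) (S D : set G).

Local Notation V := (gval G).

Lemma gval1 j : V j 1.
Proof. by elim: j => //= j IHj; exists 1 => //; exists 1; rewrite // comm1g. Qed.

Lemma gvalJ j x g : V j x -> V j (x ^ g).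
Proof.
elim: j x => //= j IHj _ [x Vx [h _ <-]]; rewrite conjRg.
by exists (x ^ g); [exact: IHj|exists (h ^ g)].
Qed.

Lemma gvalV j x : V j x -> V j x^-1.
Proof.
elim: j x => //= j IHj _ [x Vx [h _ <-]].
(* By the identity [x, h]^-1 = [x^-1, h^x]. *)
exists x^-1; first exact: IHj.
by exists (h ^ x) => //; group_word.
Qed.

Lemma gvalRl j x g : V j x -> V j.+1 [~ x, g].
Proof. by move=> Vx; exists x => //; exists g. Qed.

Lemma gvalRr j x g : V j x -> V j.+1 [~ g, x].
Proof. by move=> Vx; rewrite -invgR; apply/gvalV/gvalRl. Qed.

Lemma gvalSW j : V j.+1 `<=` V j.
Proof. by elim: j => // j IHj _ [x Vx [g _ <-]]; apply/gvalRl/IHj. Qed.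

Lemma gvalW i j : i <= j -> V j `<=` V i.
Proof.
move/subnK <-; elim: (j - i) => [|k IHk] //=.
by apply: subset_trans IHk; exact: gvalSW.
Qed.

(** Exactly [k] factors; when 1 lies in [S] this amounts to at most [k]. *)
Fixpoint products k S : set G :=
  if k is k'.+1 then [set x * y | x in S & y in products k' S] else [set 1].

Lemma products1 S x : S x -> products 1 S x.
Proof. by move=> Sx; exists x => //; exists 1; rewrite ?mulg1. Qed.

Lemma productsM k l S x y :
  products k S x -> products l S y -> products (k + l) S (x * y).
Proof.
elim: k x => [|k IHk] x; first by move=> ->; rewrite mul1g.
move=> [z Sz [u uS <-]] yS; exists z => //; exists (u * y); last by rewrite mulgA.
exact: IHk.
Qed.

Lemma productsW k l S : S 1 -> k <= l -> products k S `<=` products l S.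
Proof.
move=> S1 /subnK <- x xS; elim: (l - k) => [|i IHi] //.
by exists 1 => //; exists x; rewrite ?mul1g.
Qed.

Lemma products_sub k S D : S `<=` D -> products k S `<=` products k D.
Proof.
move=> SD; elim: k => //= k IHk _ [x Sx [y yS <-]].
by exists x; [exact: SD|exists y => //; exact: IHk].
Qed.

Lemma productsV k S x :
  (forall y, S y -> S y^-1) -> products k S x -> products k S x^-1.
Proof.
move=> SV; elim: k x => [|k IHk] x; first by move=> ->; rewrite invg1.
move=> [y Sy [z zS <-]]; rewrite invgM -addn1.
by apply: productsM; [exact: IHk|exact/products1/SV].
Qed.

Lemma productsJ k S x g :
  (forall y, S y -> S (y ^ g)) -> products k S x -> products k S (x ^ g).
Proof.
move=> SJ; elim: k x => [|k IHk] x /=; first by move=> ->; rewrite conj1g.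
move=> [y Sy [z zS <-]]; rewrite conjMg.
by exists (y ^ g); [exact: SJ|exists (z ^ g) => //; exact: IHk].
Qed.

Lemma commMg x y g : [~ x * y, g] = [~ x, g] ^ y * [~ y, g].
Proof. by group_word. Qed.

Lemma commgM x g h : [~ x, g * h] = [~ x, h] * [~ x, g] ^ h.
Proof. by group_word. Qed.

Lemma products_gvalRl k j x g :
  products k (V j) x -> products k (V j.+1) [~ x, g].
Proof.
elim: k x => [|k IHk] x; first by move=> ->; rewrite comm1g.
move=> [y Vy [z zV <-]]; rewrite commMg.
exists ([~ y, g] ^ z); first exact/gvalJ/gvalRl.
by exists [~ z, g] => //; exact: IHk.
Qed.

(* Hall-Witt: [a, b, v] is, up to conjugation, a product of inverses of
   [v, a^-1, b^-1] and [b^-1, v^-1, a]. *)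
Lemma products_gvalRR i j a v : V i a -> V j v ->
  products (2 ^ i) (V (i + j).+1) [~ a, v].
Proof.
elim: i j a v => [|i IHi] j a v.
  by move=> _ Vv; apply/products1/gvalRr.
move=> [{}a Va [b _ <-]] Vv.
have -> : [~ a, b, v] = ([~ v, a^-1, b^-1] ^ a)^-1 ^ b * ([~ b^-1, v^-1, a] ^ v)^-1 ^ b.
  by group_word.
have VJ l g y : V l y -> V l (y ^ g) by exact: gvalJ.
rewrite expnS mul2n -addnn; apply: productsM.
- apply: productsJ (VJ _ _) _; apply: productsV; first exact: gvalV.
  apply: productsJ (VJ _ _) _; rewrite addSn; apply: products_gvalRl.
  rewrite -invgR; apply: productsV; first exact: gvalV.
  by apply: IHi => //; exact: gvalV.
- apply: productsJ (VJ _ _) _; apply: productsV; first exact: gvalV.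
  apply: productsJ (VJ _ _) _; rewrite -invgR.
  apply: productsV; first exact: gvalV.
  by rewrite addSnnS; apply: IHi => //; apply/gvalRr/gvalV.
Qed.

End GammaValues.

(** * Bounded conjugation orbits and Neumann's argument *)

Fixpoint comm_products_bound q m k :=
  if k is k'.+1 then (q * m ^ k' * comm_products_bound q m k')%N else 1%N.

Section ConjBounds.
Variables (G : groupType) (m : nat) (S : set G).
Hypothesis Sm : forall x : G, bounded_by m [set x ^ s | s in S].
Implicit Types (x y z g h : G) (Y D : set G).

Lemma bounded_conj_products k x :
  bounded_by (m ^ k) [set x ^ s | s in products k S].
Proof.
elim: k x => [|k IHk] x.
  by exists [:: x] => // _ [_ -> <-]; rewrite conjg1 mem_head.
rewrite expnS; apply: sub_bounded_by; last first.
  exact: (bounded_by_bigcup (Sm x) (fun y _ => IHk y)).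
move=> _ [_ [s Ss [t tS <-]] <-]; exists (x ^ s); first by exists s.
by exists t; rewrite // conjgM.
Qed.

Lemma bounded_conj_set k d D : bounded_by d D ->
  bounded_by (d * m ^ k) [set x ^ s | x in D & s in products k S].
Proof.
move=> Dd; apply: sub_bounded_by; last first.
  exact: (bounded_by_bigcup Dd (fun y _ => bounded_conj_products k y)).
by move=> _ [x Dx [s Ss <-]]; exists x => //; exists s.
Qed.

Lemma bounded_comm_products k g :
  bounded_by (m ^ k) [set [~ s, g] | s in products k S].
Proof.
apply: sub_bounded_by; last first.
  exact: (bounded_by_image (fun y => y^-1 * g) (bounded_conj_products k g)).
by move=> _ [s Ss <-]; exists (g ^ s); [exists s|group_word].
Qed.

(** For t a product of k factors, [s t, y] = [s, y]^t [t, y]; there are [q] values of [s, y], each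
    with at most [m ^ k] conjugates by such t. *)
Lemma bounded_comm_products_set k q Y :
  bounded_by q [set [~ s, y] | s in S & y in Y] ->
  bounded_by (comm_products_bound q m k)
    [set [~ s, y] | s in products k S & y in Y].
Proof.
move=> SY; elim: k => [|k IHk].
  by exists [:: 1] => // _ [_ -> [y _ <-]]; rewrite comm1g mem_head.
apply: sub_bounded_by; last first.
  exact: (bounded_by_image2 *%g (bounded_conj_set k SY) IHk).
move=> _ [_ [s Ss [t tS <-]] [y Yy <-]]; rewrite commMg.
exists ([~ s, y] ^ t); last by exists [~ t, y] => //; exists t => //; exists y.
by exists [~ s, y]; [exists s => //; exists y|exists t].
Qed.

(* Neumann's argument: with [a ^ s_i] a largest family of distinct
   [S]-conjugates of one element, any [u] centralising all the [s_i] satisfies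
   (u a)^S = u a^S, so that all the commutators [u, g] with g in [S] lie in
   the single bounded set a^S (a^S)^-1. *)
Lemma bounded_comm_of_bounded_conj L Y :
  (forall s, S s -> bounded_by L [set s ^ y | y in Y]) ->
  bounded_by (L.+1 ^ m * (m * m * m)) [set [~ s, y] | s in S & y in Y].
Proof.
move=> SL.
pose fam k := `[< exists a (s : seq G), [/\ size s = k, {in s, forall x, S x} &
  uniq [seq a ^ x | x <- s]] >].
have fam0 : exists k, fam k by exists 0; apply/asboolP; exists 1, [::].
have famm k : fam k -> k <= m.
  move=> /asboolP[a [s [<- sS us]]]; rewrite -(size_map (fun x => a ^ x)).
  apply: uniq_size_bounded_by (Sm a) us _ => _ /mapP[x xs ->].
  by exists x => //; exact: sS.
case: (ex_maxnP fam0 famm) => k /asboolP[a [s [sk sS us]]] kmax.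
have km : k <= m by apply: famm; apply/asboolP; exists a, s.
have centU u g : {in s, forall x, x ^ u = x} -> S g ->
    exists2 x, x \in s & [~ u, g] = a ^ x * (a ^ g)^-1.
  move=> us1 Sg; have Eu x : x \in s -> (u * a) ^ x = u * a ^ x.
    move=> /us1 /conjg_fixP/commgP/commute_sym xu; rewrite conjMg; congr (_ * _).
    by apply/conjg_fixP/commgP.
  have : (u * a) ^ g \in [seq u * a ^ x | x <- s].
    apply/negPn/negP => ug; have : fam k.+1.
      apply/asboolP; exists (u * a), (g :: s); split=> /=; first by rewrite sk.
        by move=> x; rewrite inE => /orP[/eqP ->|/sS].
      have -> : [seq (u * a) ^ x | x <- s] = [seq u * a ^ x | x <- s].
        by apply/eq_in_map => x /Eu.
      by rewrite ug /= (map_comp (mul u)) (map_inj_uniq (mulgI u)).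
    by move/kmax; rewrite ltnn.
  move=> /mapP[x xs ugx]; exists x => //.
  have -> : [~ u, g] = u^-1 * (u * a) ^ g * (a ^ g)^-1 by group_word.
  by rewrite ugx mulKg.
apply: sub_bounded_by (_ : bounded_by _ ((fun p => [~ p.1, p.2]^-1) @`
    [set p : G * G | Y p.1 /\ S p.2])) => [_ [x Sx [y Yy <-]]|].
  by exists (y, x); rewrite //= invgR.
(* Pairs (y, g) are sorted by the conjugates of the s_i under y. [L.+1] keeps the base positive when
   the exponent [k] is raised to [m]. *)
apply: (bounded_by_fiber (key := fun p => [seq x ^ p.1 | x <- s])).
  apply: bounded_byW (_ : bounded_by (L.+1 ^ k) [set [seq x ^ y | x <- s] | y in Y]).
  - exact: leq_pexp2l.
  - by move=> _ [[y x] /= [Yy _] <-]; exists y.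
  - rewrite -sk; apply: bounded_by_map => x /sS Sx.
    by apply: bounded_byW (SL x Sx).
move=> [t z] /= [Yt Sz].
(* If y and t share a key, u = y t^-1 centralises the s_i, and [y, g] = [u, g]^t [t, g] with [u, g]
   in [D] and [t, g] = t^-1 t^g. *)
pose D := [set x * y^-1 | x in [set a ^ s | s in S] & y in [set a ^ s | s in S]].
have Dm : bounded_by (m * m) D by exact: bounded_by_image2.
apply: sub_bounded_by; last first.
  exact: (bounded_by_image2 (fun d e => (d ^ t * (t^-1 * e))^-1) Dm (Sm t)).
move=> _ [[y g] /= [[Yy Sg] yt] <-].
have /eq_in_map {}yt := yt.
have [x xs ug] : exists2 x, x \in s & [~ y * t^-1, g] = a ^ x * (a ^ g)^-1.
  by apply: centU => // x /yt xyt; rewrite conjgM xyt conjgK.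
exists [~ y * t^-1, g].
  rewrite ug; exists (a ^ x); first by exists x => //; exact: sS.
  by exists (a ^ g) => //; exists g.
exists (t ^ g); first by exists g.
by group_word.
Qed.

End ConjBounds.

(** * Descent on the weight of commutators *)

(** In the notation of the next lemma, the first three factors count w, and the others count
    [A w, B^-1], [A, c]^-1 and the conjugations by A^-1. *)
Definition descent_bound m q L k :=
  (m ^ k * L * L * comm_products_bound q m (k + (k + k + k)) * m ^ k * m ^ k)%N.

(* With A = [v, a], B = [v, b] and c = [a, b], the commutator [v, c] is
   (w [A w, B^-1] [A, c]^-1)^(A^-1) for w = [A, b] [B, a]^-c [B, c]^-1, where A
   and w are bounded products of elements of [gval G N] and every commutator
   occurring has been bounded beforehand. *)
Lemma bounded_comm_descent (G : groupType) m q L N i j :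
  (i + j.+1)%N = N ->
  (forall x : G, bounded_by m [set x ^ s | s in gval G N]) ->
  bounded_by q [set [~ x, y] | x in gval G N & y in gval G j.+1] ->
  (forall a, gval G i a -> bounded_by L [set [~ v, a] | v in gval G j.+1]) ->
  forall c, gval G i.+1 c ->
    bounded_by (descent_bound m q L (2 ^ i)) [set [~ v, c] | v in gval G j].
Proof.
move=> ijN Nm Nq iL c Vc; have [a Va [b _ cab]] := Vc.
set k := (2 ^ i)%N; pose P l := products l (gval G N).
have PV l x : P l x -> P l x^-1 by apply: productsV => y; exact: gvalV.
have P_comm x y : gval G i x -> gval G j.+1 y -> P k [~ y, x].
  move=> Vx Vy; rewrite -invgR; apply: PV.
  apply: products_sub (products_gvalRR Vx Vy); rewrite ijN; exact: gvalSW.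
pose W := [set x * y | x in [set x * y^-1 ^ c | x in [set [~ s, b] | s in P k]
  & y in [set [~ v, a] | v in gval G j.+1]]
  & y in (fun z : G => z^-1) @` [set [~ v, c] | v in gval G j.+1]].
have WL : bounded_by (m ^ k * L * L) W.
  apply: bounded_by_image2; last exact/bounded_by_image/iL/gvalSW.
  by apply: bounded_by_image2; [exact: bounded_comm_products|exact: iL].
have Q4 := bounded_comm_products_set Nm (k + (k + k + k)) Nq.
have R1 := bounded_by_image (fun z : G => z^-1) (bounded_comm_products Nm k c).
have M1 := bounded_by_image2 *%g (bounded_by_image2 *%g WL Q4) R1.
apply: sub_bounded_by (bounded_conj_set Nm k M1) => _ [v Vv <-].
set A := [~ v, a]; set B := [~ v, b].
have VB : gval G j.+1 B by exact: gvalRl.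
have PA : P k A.
  by rewrite /A -invgR; apply: PV; rewrite /P -ijN addnS; exact: products_gvalRR.
pose w := [~ A, b] * [~ B, a]^-1 ^ c * [~ B, c]^-1.
have Ww : W w.
  exists ([~ A, b] * [~ B, a]^-1 ^ c).
    by exists [~ A, b]; [exists A|exists [~ B, a] => //; exists B].
  by exists [~ B, c]^-1 => //; exists [~ B, c] => //; exists B.
have Pw : P (k + k + k) w.
  apply: productsM; [apply: productsM|].
  - by apply: products_sub (products_gvalRl b PA); exact: gvalSW.
  - by apply: productsJ => [y|]; [exact: gvalJ|exact/PV/P_comm].
  - by apply/PV/P_comm => //; exact: gvalSW.
exists (w * [~ A * w, B^-1] * [~ A, c]^-1).
  exists (w * [~ A * w, B^-1]); last first.
    by exists [~ A, c]^-1 => //; exists [~ A, c] => //; exists A.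
  exists w => //; exists [~ A * w, B^-1] => //.
  exists (A * w); first exact: productsM.
  by exists B^-1 => //; exact: gvalV.
exists A^-1; first exact: PV.
by rewrite /w /A /B -cab; group_word.
Qed.

Lemma bounded_gvalS m N : exists M, forall G : groupType,
  (forall x : G, bounded_by m [set x ^ s | s in gval G N]) ->
  bounded_by M (gval G N.+1).
Proof.
(* At t = N the entry y is arbitrary, so the second bound is the claim; the first bound feeds the
   descent. *)
suff H t : t <= N -> exists L q, forall G : groupType,
    (forall x : G, bounded_by m [set x ^ s | s in gval G N]) ->
    (forall a, gval G t a -> bounded_by L [set [~ v, a] | v in gval G (N - t)]) /\
    bounded_by q [set [~ x, y] | x in gval G N & y in gval G (N - t)].
  have [L [q HLq]] := H N (leqnn N); exists q => G /HLq[_].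
  by rewrite subnn.
elim: t => [_|t IHt tN].
  exists (m ^ 1)%N, (m.+1 ^ m * (m * m * m))%N => G Nm; rewrite subn0; split=> [a _|].
    apply: sub_bounded_by (bounded_comm_products Nm 1 a) => _ [v Vv <-].
    by exists v => //; exact: products1.
  exact: (bounded_comm_of_bounded_conj Nm).
have [L [q HLq]] := IHt (ltnW tN).
pose L' := descent_bound m q L (2 ^ t).
exists L', (L'.+1 ^ m * (m * m * m))%N => G Nm; have [tL Nq] := HLq G Nm.
have Nt : (N - t)%N = (N - t.+1).+1 by rewrite subnSK.
rewrite Nt in tL Nq.
have R := bounded_comm_descent _ Nm Nq tL.
have {}R a : gval G t.+1 a -> bounded_by L' [set [~ v, a] | v in gval G (N - t.+1)].
  by apply: R; rewrite -Nt subnKC// ltnW.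
(* Since t < N, the element s is also a value in [gval G t.+1], so the new first bound applies to
   it, and s^y = s [y, s]^-1. *)
split=> //; apply: (bounded_comm_of_bounded_conj Nm) => s Vs.
apply: sub_bounded_by (bounded_by_image (fun z => s * z^-1) (R s _)).
  move=> _ [y Vy <-]; exists [~ y, s]; first by exists y.
  by group_word.
exact: gvalW Vs.
Qed.

(** * Pigeonhole and shortening of products *)

Lemma bounded_by_pigeonhole (T : eqType) k (A : set T) (f : nat -> T) :
  bounded_by k A -> (forall i, A (f i)) -> exists i j, i < j <= k /\ f i = f j.
Proof.
move=> Ak Af; have : ~~ uniq (mkseq f k.+1).
  apply/negP => /(uniq_size_bounded_by Ak); rewrite size_mkseq ltnn.
  have fA x : x \in mkseq f k.+1 -> A x by move=> /mapP[i _ ->].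
  by move=> /(_ fA).
move=> /(uniqPn (f 0%N))[i [j []]]; rewrite size_mkseq => ij jk.
by rewrite !nth_mkseq ?(ltn_trans ij)// => fij; exists i, j; rewrite ij.
Qed.

(** Replaces the unknown exponent j - i produced by the pigeonhole principle by the uniform exponent
    k!. *)
Lemma subn_dvd_fact i j k : i < j <= k -> (j - i)%N %| k`!.
Proof.
by move=> /andP[ij jk]; rewrite dvdn_fact// subn_gt0 ij (leq_trans (leq_subr _ _)).
Qed.

Lemma size_le_count (T : eqType) d (s u : seq T) :
  {in s, forall x, x \in u} -> (forall x, x \in u -> count_mem x s <= d) ->
  size s <= size u * d.
Proof.
elim: u s => [|z u IHu] s su sd; first by case: s su {sd} => // x s /(_ x (mem_head _ _)).
rewrite -(count_predC (pred1 z)) mulSn leq_add ?sd ?mem_head//.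
rewrite -size_filter; apply: IHu => x.
  by rewrite mem_filter /= => /andP[xz /su]; rewrite inE (negbTE xz).
move=> xu; rewrite count_filter; apply: leq_trans (sd x _); last by rewrite inE xu orbT.
by apply: sub_count => y /andP[].
Qed.

(** No inverses are taken: this is a subgroup once [S] is closed under inversion. *)
Definition generated (G : groupType) (S : set G) : set G :=
  [set x | exists k, products k S x].

Definition normal_subgroup (G : groupType) (N : set G) :=
  [/\ N 1, forall x y, N x -> N y -> N (x * y), forall x, N x -> N x^-1 &
      forall x g, N x -> N (x ^ g)].

Section Generated.
Variable G : groupType.
Implicit Types (x y z g h c : G) (S D A : set G).

Lemma sub_generated S : S `<=` generated S.
Proof. by move=> x Sx; exists 1%N; exact: products1. Qed.

Lemma generated_normal S :
  (forall x, S x -> S x^-1) -> (forall x g, S x -> S (x ^ g)) ->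
  normal_subgroup (generated S).
Proof.
move=> SV SJ; split.
- by exists 0%N.
- by move=> x y [k xS] [l yS]; exists (k + l)%N; exact: productsM.
- by move=> x [k xS]; exists k; exact: productsV.
- by move=> x g [k xS]; exists k; apply: productsJ xS => y; exact: SJ.
Qed.

Lemma bounded_products k l S : bounded_by l S -> bounded_by (l ^ k) (products k S).
Proof.
move=> Sl; elim: k => [|k IHk]; first by exists [:: 1] => // _ ->; exact: mem_head.
by rewrite expnS; exact: bounded_by_image2.
Qed.

Lemma productsX k S x : S x -> products k S (x ^+ k).
Proof.
move=> Sx; elim: k => [|k IHk] //=.
by exists x => //; exists (x ^+ k); rewrite ?expgS.
Qed.

Lemma products_seq k S x : products k S x ->
  exists s : seq G, [/\ size s = k, {in s, forall y, S y} & x = \prod_(y <- s) y].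
Proof.
elim: k x => [|k IHk] x; first by move=> ->; exists [::]; rewrite big_nil.
move=> [y Sy [z /IHk[s [sk sS ->]] <-]]; exists (y :: s); rewrite /= sk big_cons.
by split=> // t; rewrite inE => /orP[/eqP ->|/sS].
Qed.

(** An entry y moves past a power of c by y c^i = c^i y^(c^i), and y^(c^i) is still in [S]. *)
Lemma products_collect S c (s : seq G) :
  (forall x, S x -> S (x ^ c)) -> {in s, forall y, S y} ->
  exists2 p, products (size s - count_mem c s) S p &
    \prod_(y <- s) y = c ^+ count_mem c s * p.
Proof.
move=> Sc; elim: s => [_|y s IHs sS].
  by exists 1; rewrite // big_nil mulg1.
have [|p pS ps] := IHs; first by move=> x xs; apply: sS; rewrite inE xs orbT.
rewrite big_cons ps /=; have [->|yc] := eqVneq y c.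
  by exists p; rewrite // add1n expgS mulgA.
rewrite add0n subSn ?count_size//; exists (y ^ (c ^+ count_mem c s) * p); last first.
  by rewrite [LHS]mulgA [RHS]mulgA -conjgC.
exists (y ^ (c ^+ count_mem c s)); last by exists p.
have Sy : S y by apply: sS; rewrite mem_head.
elim: (count_mem c s) => [|i IHi]; first by rewrite conjg1.
by rewrite expgSr conjgM; exact: Sc.
Qed.

(* In a long product some c occurs more than d times; these occurrences can be
   moved to the front and shortened. *)
Lemma generated_shorten S M d :
  S 1 -> bounded_by M S -> (forall x y, S x -> S y -> S (x ^ y)) ->
  (forall c, S c -> products d S (c ^+ d.+1)) ->
  bounded_by (M ^ (M * d)) (generated S).
Proof.
move=> S1 SM SJ Sd; apply: sub_bounded_by (bounded_products (M * d) SM).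
move=> x [k]; have [kMd|] := leqP k (M * d); first exact: productsW.
elim: k => // k IHk; rewrite ltnS => Mdk xS.
suff xS' : products k S x.
  by move: Mdk; rewrite leq_eqVlt => /orP[/eqP -> //|/IHk]; apply.
have [s [sk sS ->]] := products_seq xS.
have [c cs dc] : exists2 c, c \in s & d < count_mem c s.
  apply/hasP/negPn/negP => /hasPn sd.
  have [u uM Su] := SM; have : size s <= size u * d.
    apply: size_le_count => [y /sS/Su//|y yu].
    have [/sd|ys] := boolP (y \in s); first by rewrite -leqNgt.
    by rewrite (count_memPn ys).
  by move=> /leq_trans /(_ (leq_mul uM (leqnn d))); rewrite sk leqNgt ltnS Mdk.
have Sc := sS c cs.
have [p pS ->] := products_collect (fun x Sx => SJ x c Sx Sc) sS.
rewrite -(subnKC dc) expgnDr.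
(* Writing [c ^+ d.+1] with d factors from [S] saves exactly one factor. *)
have -> : k = (d + (count_mem c s - d.+1) + (size s - count_mem c s))%N.
  apply: succn_inj; rewrite -sk -!addSn (subnKC dc) subnKC//.
  exact: count_size.
by apply: productsM pS; apply: productsM (Sd c Sc) (productsX _ Sc).
Qed.

Lemma generated_torsion S M e :
  S 1 -> bounded_by M S -> (forall x y, S x -> S y -> S (x ^ y)) ->
  (forall c, S c -> c ^+ e.+1 = 1) ->
  bounded_by (M ^ (M * e)) (generated S).
Proof.
move=> S1 SM SJ Se; apply: generated_shorten => // c /Se ->.
by apply: productsW (leq0n e) _ _.
Qed.

End Generated.

(** * Commutators additive in the first entry modulo a normal subgroup *)

Section Torsion.
(** [E k] contains the commutators with k further entries, and [N k] the error terms. Two instances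
    follow: constantly gamma_r(G) and its derived subgroup, or consecutive terms of the lower
    central series. *)
Variables (G : groupType) (E N : nat -> set G).
Hypothesis Nn : forall k, normal_subgroup (N k).
Hypothesis EE : forall k x g, E k x -> E k.+1 [~ x, g].
Hypothesis NN : forall k x g, N k x -> N k.+1 [~ x, g].
Hypothesis EN : forall k x y, E k.+1 x -> E k y -> N k.+1 [~ x, y].

Lemma foldl_comm_in (s : seq G) v : E 0 v -> E (size s) (foldl (@commg G) v s).
Proof.
elim/last_ind: s => // s g IHs /IHs Es.
by rewrite size_rcons foldl_rcons; exact: EE.
Qed.

Lemma foldl_commM (s : seq G) v w : E 0 v -> E 0 w ->
  exists2 z, N (size s) z &
    foldl (@commg G) (v * w) s = foldl (@commg G) v s * foldl (@commg G) w s * z.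
Proof.
move=> Ev Ew; elim/last_ind: s => [|s g [z Nz]].
  by exists 1; rewrite /= ?mulg1//; case: (Nn 0).
rewrite size_rcons !foldl_rcons => ->.
have := foldl_comm_in s Ev; have := foldl_comm_in s Ew.
set x := foldl _ v s; set y := foldl _ w s => Ey Ex.
have [_ NM NV NJ] := Nn (size s).+1.
(* From [x y z, g] = [x y, g]^z [z, g] and [x y, g] = [x, g] [y, g] [x, g, y]^[y, g]. *)
exists ([~ x, g, y] ^ [~ y, g] * [~ z, [~ x * y, g]]^-1 * [~ z, g]); last by group_word.
apply: (NM); last exact: NN.
by apply: (NM); [apply/NJ/EN => //; exact: EE|apply/NV/NN].
Qed.

Hypothesis E0X : forall v i, E 0 v -> E 0 (v ^+ i).

Lemma foldl_commX (s : seq G) v i : E 0 v ->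
  exists2 z, N (size s) z &
    foldl (@commg G) (v ^+ i) s = foldl (@commg G) v s ^+ i * z.
Proof.
move=> Ev; have [N1 NM NV NJ] := Nn (size s).
elim: i => [|i [z Nz IHi]].
  exists 1 => //; rewrite expg0 !mulg1.
  by elim: s {N1 NM NV NJ} => //= g s IHs; rewrite comm1g.
have [t Nt] := foldl_commM s Ev (E0X i Ev).
rewrite -expgS IHi => ->; exists (z * t); first exact: NM.
by rewrite expgS !mulgA.
Qed.

(** Two pigeonholes: among the values at the powers of v two coincide, which puts a power of the
    commutator in [N (size s)]; since that subgroup is bounded, a further power is trivial. *)
Lemma foldl_comm_torsion (s : seq G) v M F A :
  E 0 v -> bounded_by M A -> bounded_by F (N (size s)) ->
  (forall i, A (foldl (@commg G) (v ^+ i) s)) ->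
  foldl (@commg G) v s ^+ (M`! * F`!) = 1.
Proof.
move=> Ev AM NF As; have [N1 NM NV NJ] := Nn (size s).
have [i [j [ijM]]] := bounded_by_pigeonhole AM As.
have /dvdnP[q ->] := subn_dvd_fact ijM.
have [z Nz ->] := foldl_commX s i Ev; have [t Nt ->] := foldl_commX s j Ev.
set c := foldl _ v s => ct.
have Nc : N (size s) (c ^+ (j - i)).
  have /andP[/ltnW ij _] := ijM.
  have -> : c ^+ (j - i) = z * t^-1.
    by apply: (mulgI (c ^+ i)); rewrite -expgnDr subnKC// mulgA ct mulgK.
  by apply/NM/NV.
have NX x l : N (size s) x -> N (size s) (x ^+ l).
  by move=> Nx; elim: l => // l IHl; rewrite expgS; exact: NM.
have [a [b [abF]]] := bounded_by_pigeonhole NF (fun l => NX (c ^+ (j - i)) l Nc).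
have /dvdnP[p ->] := subn_dvd_fact abF => cab.
have c1 : c ^+ (j - i) ^+ (b - a) = 1.
  have /andP[/ltnW ab _] := abF.
  by apply: (mulgI (c ^+ (j - i) ^+ a)); rewrite -expgnDr subnKC// mulg1.
by rewrite mulnACA mulnC expgnA (expgnA c) c1 expg1n.
Qed.

End Torsion.

(** * Schur's theorem *)

(** [l] bounds the number of commutators: each entry matters only through its conjugation action on
    [S], with at most [M ^ M] possibilities. The power comes from shortening with d = M!. *)
Definition schur_bound M :=
  let l := (M ^ M * M ^ M)%N in (l ^ (l * M`!))%N.

Section Conciseness.
Variable G : groupType.
Implicit Types (x y z g h c : G) (S D : set G).

(* Schur's theorem. For c = [y, g] the power c^d with d = M! is fixed by every
   g in the group, so c^(d+1) = c (c^g)^d = [y, g^2] (c^g)^(d-1) is a product of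
   d commutators, and products of commutators can be shortened. *)
Lemma generated_derived_bounded S M :
  S 1 -> bounded_by M S ->
  (forall x, S x -> S x^-1) -> (forall x g, S x -> S (x ^ g)) ->
  bounded_by (schur_bound M)
    (generated [set [~ a, b] | a in generated S & b in generated S]).
Proof.
move=> S1 [s0 s0M Ss0] SV SJ; have [_ EM EV EJ] := generated_normal SV SJ.
have [s sM Ss] : exists2 s : seq G, size s <= M & forall x, S x <-> x \in s.
  exists [seq x <- s0 | `[< S x >]].
    by rewrite size_filter (leq_trans (count_size _ _)).
  move=> x; rewrite mem_filter; split=> [Sx|/andP[/asboolP//]].
  by rewrite Ss0// andbT; exact/asboolP.
have SM : bounded_by M S by exists s => // x /Ss.
have M0 : 0 < M by apply: leq_trans sM; have /Ss := S1; case: (s).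
have key_conj g h : [seq x ^ g | x <- s] = [seq x ^ h | x <- s] ->
    forall x, generated S x -> x ^ g = x ^ h.
  move=> /eq_in_map gh x [k]; elim: k x => [|k IHk] x.
    by move=> ->; rewrite !conj1g.
  by move=> [y /Ss/gh yS [z /IHk zS <-]]; rewrite !conjMg yS zS.
set E := generated S in EM EV EJ key_conj *.
pose D := [set [~ a, b] | a in E & b in E].
pose l := (M ^ M * M ^ M)%N.
have keyM : bounded_by (M ^ M) [set [seq x ^ a | x <- s] | a in E].
  apply: bounded_byW (leq_pexp2l M0 sM) (@subset_refl _ _) _.
  apply: bounded_by_map => x /Ss Sx.
  by apply: sub_bounded_by SM => _ [a _ <-]; exact: SJ.
have Dl : bounded_by l D.
  apply: sub_bounded_by (_ : bounded_by l
    ((fun p => [~ p.1, p.2]) @` [set p : G * G | E p.1 /\ E p.2])).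
    by move=> _ [a Ea [b Eb <-]]; exists (a, b).
  (* [a, b] = (b^a)^-1 b = a^-1 a^b depends only on the actions of a and b on [E], which are
     determined on the list [s]. *)
  apply: (bounded_by_key (key := fun p =>
    ([seq x ^ p.1 | x <- s], [seq x ^ p.2 | x <- s]))).
    apply: sub_bounded_by (bounded_by_image2 pair keyM keyM).
    move=> _ [[a b] /= [Ea Eb] <-]; exists [seq x ^ a | x <- s]; first by exists a.
    by exists [seq x ^ b | x <- s] => //; exists b.
  move=> [a b] [a' b'] /= [Ea Eb] [Ea' Eb'] [/key_conj aa /key_conj bb].
  have -> : [~ a, b] = (b ^ a)^-1 * b by group_word.
  rewrite aa//; have -> : (b ^ a')^-1 * b = a'^-1 * a' ^ b by group_word.
  by rewrite bb.
have DJ x g : D x -> D (x ^ g).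
  by move=> [a Ea [b Eb <-]]; exists (a ^ g); [exact: EJ|exists (b ^ g); rewrite ?conjRg//; exact: EJ].
have D1 : D 1.
  by exists 1; [exists 0%N|exists 1; [exists 0%N|rewrite comm1g]].
have cent c x : E x -> x ^ (c ^+ M`!) = x.
  move=> Ex; rewrite -[RHS]conjg1; apply: key_conj Ex; apply/eq_in_map => {}x /Ss Sx.
  (* Some c^(j-i) with 0 < j - i <= M fixes x, hence so does c^(M!). *)
  have [i [j [ijM]]] := bounded_by_pigeonhole SM (fun i => SJ x (c ^+ i) Sx).
  have /dvdnP[q ->] := subn_dvd_fact ijM.
  have /andP[/ltnW ij _] := ijM; rewrite -{1}(subnK ij) expgnDr conjgM => /conjg_inj xc.
  rewrite conjg1 mulnC expgnA; elim: q => [|q IHq]; first by rewrite conjg1.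
  by rewrite expgS conjgM -xc.
apply: generated_shorten => // [x y Dx _|c Dc]; first exact: DJ.
have [y Ey [g Eg ycg]] := Dc.
have [d dM] : exists d, M`! = d.+1 by exists M`!.-1; rewrite prednK// fact_gt0.
have cg : (c ^+ M`!) ^ g = c ^+ M`!.
  by apply/conjg_fixP/commgP/commute_sym/commgP/conjg_fixP/cent.
have -> : c ^+ M`!.+1 = [~ y, g * g] * (c ^ g) ^+ d.
  by rewrite expgS -cg conjXg dM expgS commgM ycg mulgA.
rewrite dM -add1n; apply: productsM; last exact/productsX/DJ.
apply: products1; exists y => //; exists (g * g) => //; exact: EM.
Qed.


End Conciseness.

(** * From bounded sets of values to bounded lower central terms *)

Lemma gval_foldl (G : groupType) i (s : seq G) x :
  gval G i x -> gval G (i + size s) (foldl (@commg G) x s).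
Proof.
move=> Vx; elim/last_ind: s => [|s g IHs]; first by rewrite addn0.
by rewrite size_rcons addnS foldl_rcons; exact: gvalRl.
Qed.

Lemma gval_foldlP (G : groupType) i k x : gval G (i + k) x ->
  exists v (s : seq G), [/\ gval G i v, size s = k & x = foldl (@commg G) v s].
Proof.
elim: k x => [|k IHk] x; first by rewrite addn0 => Vx; exists x, [::].
rewrite addnS => -[y /IHk[v [s [Vv sk ->]]] [g _ <-]].
by exists v, (rcons s g); rewrite size_rcons sk foldl_rcons.
Qed.

Section BoundedValues.
Variables (G : groupType) (M N : nat).
Hypothesis NM : bounded_by M (gval G N).
Local Notation V := (gval G).
Local Notation gen j := (generated (gval G j)).

Lemma gen_gval_normal j : normal_subgroup (gen j).
Proof. by apply: generated_normal => x *; [exact: gvalV|exact: gvalJ]. Qed.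

Lemma gen_gvalR j x g : gen j x -> gen j.+1 [~ x, g].
Proof. by move=> [k xV]; exists k; exact: products_gvalRl. Qed.

Lemma gen_gval_bounded_of_torsion j e : N <= j ->
  (forall x, V j x -> x ^+ e.+1 = 1) -> bounded_by (M ^ (M * e)) (gen j).
Proof.
move=> Nj Ve; apply: generated_torsion => //; first exact: gval1.
- exact: sub_bounded_by (gvalW Nj) NM.
- by move=> x y Vx _; exact: gvalJ.
Qed.

(* Modulo the derived subgroup of E = <X>, the map v |-> [v, g_1, ..., g_N] is
   additive on E, and all its values lie in the finite set X because the first
   entry of a commutator in X is arbitrary. *)
Lemma gen_gval_double_bounded :
  bounded_by (M ^ (M * (M`! * (schur_bound M)`!).-1)) (gen (N + N)).
Proof.
apply: gen_gval_bounded_of_torsion => [|x]; first exact: leq_addr.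
rewrite prednK ?muln_gt0 ?fact_gt0// => /gval_foldlP[v [s [Vv sN ->]]].
have [E1 EM EV EJ] := gen_gval_normal N.
pose D := [set [~ a, b] | a in gen N & b in gen N].
have Dn : normal_subgroup (generated D).
  apply: generated_normal => y.
    by move=> [a Ea [b Eb <-]]; rewrite invgR; exists b => //; exists a.
  move=> g [a Ea [b Eb <-]]; exists (a ^ g); first exact: EJ.
  by exists (b ^ g); rewrite ?conjRg//; exact: EJ.
have ER y g : gen N y -> gen N [~ y, g].
  by move=> Ex; rewrite commgEl; apply: (EM); [exact: EV|exact: EJ].
apply: (@foldl_comm_torsion _ (fun=> gen N) (fun=> generated D) _ _ _ _ _
    s v M _ (V N)) => //.
- move=> k y g Dy; have [_ DM DV DJ] := Dn.
  by rewrite commgEl; apply: DM; [exact: DV|exact: DJ].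
- by move=> k y z Ey Ez; apply: sub_generated; exists y => //; exists z.
- by move=> y i Ey; elim: i => // i IHi; rewrite expgS; exact: EM.
- exact: sub_generated.
- apply: generated_derived_bounded => //; first exact: gval1.
    by move=> y; exact: gvalV.
  by move=> y g; exact: gvalJ.
- by move=> i; have := @gval_foldl G 0 s (v ^+ i) I; rewrite sN.
Qed.

(** The torsion argument runs with [E k] and [N k] consecutive lower central terms; the first entry
    is any element of G, and N <= j keeps all values in the bounded set [gval G N]. *)
Lemma gen_gval_bounded_of_succ F j : N <= j -> bounded_by F (gen j.+1) ->
  bounded_by (M ^ (M * (M`! * F`!).-1)) (gen j).
Proof.
move=> Nj jF; apply: gen_gval_bounded_of_torsion => // x.
rewrite prednK ?muln_gt0 ?fact_gt0//.
rewrite -[j]add0n => /gval_foldlP[v [s [_ sj ->]]].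
apply: (@foldl_comm_torsion _ (fun k => gen k) (fun k => gen k.+1) _ _ _ _ _
    s v M _ (V N)) => //.
- by move=> k; exact: gen_gval_normal.
- by move=> k y g; exact: gen_gvalR.
- by move=> k y g; exact: gen_gvalR.
- by move=> k y z Ey _; exact: gen_gvalR.
- by move=> y i _; exists 1%N; exact: products1.
- by exists 1%N; exact: products1.
- by rewrite sj.
- move=> i; apply: (gvalW Nj); rewrite -sj.
  exact: (@gval_foldl G 0 s (v ^+ i) I).
Qed.

End BoundedValues.

Lemma gen_gval_bounded M N : exists F, forall G : groupType,
  bounded_by M (gval G N) -> bounded_by F (generated (gval G N)).
Proof.
(* The index descends from N + N, settled through Schur's theorem, to N. *)
suff H t : t <= N -> exists F, forall G : groupType,
    bounded_by M (gval G N) -> bounded_by F (generated (gval G (N + N - t))).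
  by have [F HF] := H N (leqnn N); exists F => G /HF; rewrite addnK.
elim: t => [_|t IHt tN].
  exists (M ^ (M * (M`! * (schur_bound M)`!).-1))%N => G NM.
  by rewrite subn0; exact: gen_gval_double_bounded.
have [F HF] := IHt (ltnW tN); exists (M ^ (M * (M`! * F`!).-1))%N => G NM.
apply: (gen_gval_bounded_of_succ NM); first by rewrite -addnBA// leq_addr.
by rewrite -subSn ?(leq_trans tN) ?leq_addr// subSS; exact: HF.
Qed.

Lemma lower_central_term_sub (G : groupType) j :
  lower_central_term j.+1 G `<=` generated (gval G j).
Proof.
elim: j => [|j IHj]; first by move=> x _; exact: sub_generated.
have [H1 HM HV _] := @gen_gval_normal G j.+1.
apply: smallest_sub.
  split=> [|x y]; rewrite !in_setE//= => Hx Hy.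
  by apply: (HM) => //; exact: HV.
by move=> _ [a /IHj Ha [g _ <-]]; exact: gen_gvalR.
Qed.

Theorem corollary1p3 :
  exists f : nat -> nat -> nat,
    (forall m n : nat, 0 < m -> 0 < n -> 0 < f m n) /\
    forall (m n : nat) (G : groupType),
      0 < m -> 0 < n ->
      (forall x : G, conj_by x (gamma_values n G) #<= `I_m) ->
      finite_set (lower_central_term n.+1 G) /\
      lower_central_term n.+1 G #<= `I_(f m n).
Proof.
(* Pairing m and n lets a single use of choice produce the bound; [p.2.-1] undoes the index shift of
   [gval]. *)
have H (p : nat * nat) : exists F, forall G : groupType,
    (forall x : G, bounded_by p.1 [set x ^ s | s in gval G p.2.-1]) ->
    bounded_by F (lower_central_term p.2.-1.+2 G).
  case: p => m N /=; have [M HM] := bounded_gvalS m N.-1.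
  have [F HF] := gen_gval_bounded M N.-1.+1; exists F => G /HM/HF.
  exact/sub_bounded_by/lower_central_term_sub.
have [f Hf] := choice H.
(* The successor makes the bound positive. *)
exists (fun m n => (f (m, n)).+1); split=> // m [//|n] G _ _ Gm.
have Gf : lower_central_term n.+2 G #<= `I_(f (m, n.+1)).+1.
  apply/bounded_byP; apply: bounded_byW (leqnSn _) (@subset_refl _ _) _.
  apply: (Hf (m, n.+1)) => x /=; apply/bounded_byP; rewrite -gamma_valuesE.
  exact: Gm.
by split=> //; apply/finite_set_leP; exists (f (m, n.+1)).+1.
Qed.
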